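(* Let $\phi=\psi^{-1}:\psi(U)\to\mathbb{R}^r$ be the inverse of a chart $\psi:U\to\mathbb{R}^n$ of an $n$-dimensional submanifold $M\subseteq\mathbb{R}^r$, and consider the It\^o SDEs $$dX_t=a(X_t,t)\,dt+b_\alpha(X_t,t)\,dW^\alpha_t,\quad X_0\in U,\qquad\qquad dY_t=A(Y_t,t)\,dt+B_\alpha(Y_t,t)\,dW^\alpha_t,\quad Y_0=\psi(X_0),$$ on $\mathbb{R}^r$ and on $\psi(U)\subseteq\mathbb{R}^n$ respectively, with $X_0$ deterministic. In order that the coefficient $A$ at time $0$ minimize the norm of the expectation of the order $1$ weak It\^o--Taylor expansion of $X_t-\phi(Y_t)$ (for $t>0$), one must take $$A(Y_0,0)=(\psi_* )_{X_0}\,\Pi_{X_0}\Big(a(X_0,0)-\tfrac12\big(\nabla_{B_\alpha(Y_0,0)}\phi_*\big)B_\beta(Y_0,0)\,g_E^{\alpha\beta}\Big).$$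
   Context: Einstein summation is used. $W^1,\dots,W^m$ are independent standard Brownian motions; $g_E^{\alpha\beta}=\delta^{\alpha\beta}$. $U$ is an open neighbourhood in $M$. For $x\in M$, $\Pi_x:\mathbb{R}^r\to T_xM$ is the Euclidean orthogonal projection; $\phi_*$ is the differential of $\phi$; $(\psi_* )_x:T_xM\to\mathbb{R}^n$ is the differential of $\psi$ (the inverse of $\phi_*$ onto $T_xM$). For a smooth map $F$ and vectors $v,w$, $(\nabla_vF_* )w=v^iw^j\,\partial_i\partial_jF$. Weak It\^o--Taylor expansions: consider an SDE $dZ_t=a(Z_t,t)dt+b_\alpha(Z_t,t)dW^\alpha_t$ (for functions of a pair such as $(X_t,Y_t)$, apply the following to the stacked SDE driven by the same Brownian motions). A multi-index $\xi$ is a finite (possibly empty) list of integers in $\{0,\dots,m\}$; $l(\xi)$ is its length; $\xi_1,\xi_{-1}$ are its first and last entries, $-\xi$ and $\xi-$ the result of deleting the first, respectively last, entry. Put $W^0_t=t$. Define $I^{()}_{t_1,t_2}(f)=f(t_2)$ and $I^\xi_{t_1,t_2}(f)=\int_{t_1}^{t_2}I^{\xi-}_{t_1,s}(f)\,dW^{\xi_{-1}}_s$ otherwise. Define $L_{()}f=f$, $L_{(0)}f=\frac{\partial f}{\partial t}+a^i\frac{\partial f}{\partial x^i}+\frac12b^i_\alpha b^j_\beta g_E^{\alpha\beta}\frac{\partial^2f}{\partial x^i\partial x^j}$, $L_{(\alpha)}f=b^i_\alpha\frac{\partial f}{\partial x^i}$ for $\alpha\ge1$, and $L_\xi f=L_{(\xi_1)}(L_{-\xi}f)$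 for $l(\xi)>1$. The weak It\^o--Taylor expansion of order $\beta\in\{0,1,2,\dots\}$ of $f(Z_t)$ (based at time $0$) is $\sum_{l(\xi)\le\beta}(L_\xi f)|_{(0,Z_0)}\,I^\xi_{0,t}(1)$. All derivatives needed are assumed to exist. *)

(* Defs.v *)
From HB Require Import structures.
From mathcomp Require Import all_boot all_order all_algebra.
From mathcomp Require Import all_classical all_reals all_analysis.
Import Order.TTheory GRing.Theory Num.Theory.
Import numFieldNormedType.Exports.

Set Implicit Arguments.
Unset Strict Implicit.
Unset Printing Implicit Defensive.

Local Open Scope classical_set_scope.
Local Open Scope ring_scope.

(* Vectors of R^n are row vectors.  The library norm on 'rV[R]_n is the sup
   norm; it is used only for its topology, hence the Euclidean one below. *)

Definition dot (R : realType) (n : nat) (u v : 'rV[R]_n) : R :=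
  \sum_i u 0 i * v 0 i.

Definition enorm (R : realType) (n : nat) (u : 'rV[R]_n) : R :=
  Num.sqrt (dot u u).

Definition gE (R : realType) (m : nat) (alpha beta : 'I_m) : R :=
  (alpha == beta)%:R.

(* [orth_proj S u] is the point p of S with u - p orthogonal to S; it exists
   and is unique when S is a linear subspace. *)
Definition orth_proj (R : realType) (n : nat) (S : set 'rV[R]_n)
    (u : 'rV[R]_n) : 'rV[R]_n :=
  xget 0 [set p | S p /\ forall w, S w -> dot (u - p) w = 0].

Definition partial (R : realType) (n : nat) (V : normedModType R) (i : 'I_n)
    (f : 'rV[R]_n -> V) (x : 'rV[R]_n) : V :=
  'D_(delta_mx 0 i) f x.

Fixpoint Ck (R : realType) (n : nat) (V : normedModType R) (k : nat)
    (D : set 'rV[R]_n) (f : 'rV[R]_n -> V) {struct k} : Prop :=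
  match k with
  | 0 => forall x, D x -> {for x, continuous f}
  | k'.+1 => (forall x, D x -> differentiable f x) /\
             forall i : 'I_n, Ck k' D (partial i f)
  end.

Definition smooth_on (R : realType) (n : nat) (V : normedModType R)
    (D : set 'rV[R]_n) (f : 'rV[R]_n -> V) : Prop :=
  forall k, Ck k D f.

(* psi : U -> R^n is a chart of the subset M of R^r with inverse phi: U is
   relatively open in M, and phi is a smooth immersion of the open set psi(U)
   that is a homeomorphism onto U.  The values of psi off U and of phi off
   psi(U) are irrelevant. *)
Definition chart (R : realType) (r n : nat) (M U : set 'rV[R]_r)
    (psi : 'rV[R]_r -> 'rV[R]_n) (phi : 'rV[R]_n -> 'rV[R]_r) : Prop :=
  [/\ exists2 O : set 'rV[R]_r, open O & U = M `&` O,
      open (psi @` U),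
      {within U, continuous psi},
      {in U, cancel psi phi} &
      smooth_on (psi @` U) phi /\
      forall y, (psi @` U) y -> injective ('d phi y)].

Definition submanifold (R : realType) (r n : nat) (M : set 'rV[R]_r) : Prop :=
  forall x, M x -> exists U (psi : 'rV[R]_r -> 'rV[R]_n) phi,
    chart M U psi phi /\ U x.

(* The velocities at x of the differentiable curves in M through x. *)
Definition tangent (R : realType) (r : nat) (M : set 'rV[R]_r)
    (x : 'rV[R]_r) : set 'rV[R]_r :=
  [set v | exists gamma : R -> 'rV[R]_r,
     [/\ gamma 0 = x, \forall s \near (0 : R), M (gamma s) &
         is_derive (0 : R) 1 gamma v]].

(* The differential at phi y of the inverse of phi, i.e. the inverse of the
   injective linear map phi_* at y, from its range to R^n. *)
Definition inv_diff (R : realType) (r n : nat) (phi : 'rV[R]_n -> 'rV[R]_r)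
    (y : 'rV[R]_n) (v : 'rV[R]_r) : 'rV[R]_n :=
  xget 0 [set w | 'd phi y w = v].

Definition nabla_diff (R : realType) (r n : nat) (F : 'rV[R]_n -> 'rV[R]_r)
    (y v w : 'rV[R]_n) : 'rV[R]_r :=
  \sum_i \sum_j (v 0 i * w 0 j) *: partial i (partial j F) y.

Section probability.
Context {d : measure_display} {T : measurableType d} {R : realType}.
Variable P : probability T R.

(* For classes of events that contain the whole space, the product rule over
   the full finite index type yields the one over every subfamily. *)
Definition independent_classes (I : finType) (C : I -> set (set T)) : Prop :=
  forall E : I -> set T, (forall i, C i (E i)) ->
    P (\bigcap_i E i) = (\prod_(i : I) P (E i))%E.

Definition rv_events (X : T -> R) : set (set T) :=
  [set X @^-1` B | B in measurable].

(* Processes are indexed by R, but only the times t >= 0 are used. *)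
Definition cylinder_events (X : R -> T -> R) : set (set T) :=
  [set E | exists (K : nat) (u : 'I_K -> R) (B : 'I_K -> set R),
     [/\ forall k, 0 <= u k, forall k, measurable (B k) &
         E = \bigcap_k (X (u k) @^-1` B k)]].

Definition brownian_motion (X : R -> {RV P >-> R}) : Prop :=
  [/\ {ae P, forall w, X 0 w = 0},
      {ae P, forall w, {within `[0, +oo[, continuous (fun t => X t w)}},
      (forall (K : nat) (u : nat -> R), 0 <= u 0%N ->
         (forall k, (k < K)%N -> u k <= u k.+1) ->
         independent_classes
           (fun k : 'I_K => rv_events (fun w => X (u k.+1) w - X (u k) w))) &
      (* the second parameter of [normal_prob] is the standard deviation *)
      forall s t, 0 <= s -> s < t -> forall B : set R, measurable B ->
        P ((fun w => X t w - X s w) @^-1` B) =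
        normal_prob 0 (Num.sqrt (t - s)) B].

Definition independent_brownian_motions (m : nat)
    (W : 'I_m -> R -> {RV P >-> R}) : Prop :=
  (forall alpha, brownian_motion (W alpha)) /\
  independent_classes (fun alpha => cylinder_events (W alpha)).

Definition subdivision (t1 t2 delta : R) (K : nat) (u : nat -> R) : Prop :=
  [/\ u 0%N = t1, u K = t2 &
      forall k, (k < K)%N -> u k <= u k.+1 /\ u k.+1 - u k < delta].

Definition riemann_sum (H V : R -> T -> R) (K : nat) (u : nat -> R) (w : T) : R :=
  \sum_(k < K) H (u k) w * (V (u k.+1) w - V (u k) w).

(* int_{t1}^{t2} H_s dV_s as the limit in probability, as the mesh tends to 0,
   of the left-endpoint Riemann sums.  For H continuous and adapted this is
   the Ito integral when V is a Brownian motion, and the pathwise integral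
   when V_t = t.  It only depends on H and V up to modification, and is
   determined up to a null event, among which [xget] chooses a version. *)
Definition stoch_int (H V : R -> T -> R) (t1 t2 : R) : T -> R :=
  xget (cst 0) [set J : T -> R | measurable_fun setT J /\
    forall e : R, 0 < e -> exists2 delta : R, 0 < delta &
      forall K u, subdivision t1 t2 delta K u ->
        (P [set w | (e <= `|J w - riemann_sum H V K u w|)%R] <= e%:E)%E].

(* W^0_t = t: the indices 0 and alpha + 1 of 'I_m.+1 stand for dt and for the
   Brownian motion of index alpha. *)
Definition time_ext (m : nat) (W : 'I_m -> R -> T -> R) (k : 'I_m.+1) :
    R -> T -> R :=
  if unlift ord0 k is Some alpha then W alpha else fun t _ => t.

Fixpoint iterated_int_rev (m : nat) (W : 'I_m -> R -> T -> R)
    (rxi : seq 'I_m.+1) (t1 t2 : R) (f : R -> T -> R) {struct rxi} : T -> R :=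
  match rxi with
  | [::] => f t2
  | k :: rxi' => stoch_int (fun s => iterated_int_rev W rxi' t1 s f)
                           (time_ext W k) t1 t2
  end.

(* The recursion removes the last entry of the multi-index. *)
Definition iterated_int (m : nat) (W : 'I_m -> R -> T -> R)
    (xi : seq 'I_m.+1) (t1 t2 : R) (f : R -> T -> R) : T -> R :=
  iterated_int_rev W (rev xi) t1 t2 f.

Definition vexpectation (n : nat) (X : T -> 'rV[R]_n) : 'rV[R]_n :=
  \row_j fine 'E_P[fun w => X w 0 j].

End probability.

(* dZ_t = drift(Z_t, t) dt + diffusion_alpha(Z_t, t) dW^alpha_t with
   deterministic Z_0 = init. *)
Record sde (R : realType) (q m : nat) := Sde {
  drift : 'rV[R]_q -> R -> 'rV[R]_q;
  diffusion : 'I_m -> 'rV[R]_q -> R -> 'rV[R]_q;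
  init : 'rV[R]_q }.

Definition stack (R : realType) (p q m : nat) (S : sde R p m) (S' : sde R q m) :
    sde R (p + q) m :=
  Sde (fun z t => row_mx (drift S (lsubmx z) t) (drift S' (rsubmx z) t))
      (fun alpha z t => row_mx (diffusion S alpha (lsubmx z) t)
                               (diffusion S' alpha (rsubmx z) t))
      (row_mx (init S) (init S')).

Section ito_taylor.
Context {R : realType} {q m : nat} {V : normedModType R}.
Variable S : sde R q m.

Definition L0 (f : 'rV[R]_q -> R -> V) (x : 'rV[R]_q) (t : R) : V :=
  derive1 (f x) t
  + \sum_i drift S x t 0 i *: partial i (f^~ t) x
  + 2^-1 *: \sum_i \sum_j \sum_alpha \sum_beta
      (diffusion S alpha x t 0 i * diffusion S beta x t 0 j
        * gE R alpha beta) *: partial i (partial j (f^~ t)) x.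

Definition Lalpha (alpha : 'I_m) (f : 'rV[R]_q -> R -> V) (x : 'rV[R]_q)
    (t : R) : V :=
  \sum_i diffusion S alpha x t 0 i *: partial i (f^~ t) x.

Definition Lentry (k : 'I_m.+1) : ('rV[R]_q -> R -> V) -> 'rV[R]_q -> R -> V :=
  if unlift ord0 k is Some alpha then Lalpha alpha else L0.

Definition Lop (xi : seq 'I_m.+1) (f : 'rV[R]_q -> R -> V) :
    'rV[R]_q -> R -> V :=
  foldr Lentry f xi.

(* The multi-indices of length l are the l-tuples over 'I_m.+1. *)
Definition weak_ito_taylor {d : measure_display} {T : measurableType d}
    (P : probability T R) (W : 'I_m -> R -> T -> R) (beta : nat)
    (f : 'rV[R]_q -> R -> V) (t : R) (w : T) : V :=
  \sum_(l < beta.+1) \sum_(xi : l.-tuple 'I_m.+1)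
    iterated_int P W xi 0 t (fun _ _ => 1) w *: Lop xi f (init S) 0.

End ito_taylor.

(* Main.v *)
Require Import Defs.
From HB Require Import structures.
From mathcomp Require Import all_boot all_order all_algebra.
From mathcomp Require Import all_classical all_reals all_analysis.
From mathcomp Require Import measurable_realfun ring lra.
Import Order.TTheory GRing.Theory Num.Theory.
Import numFieldNormedType.Exports.

Set Implicit Arguments.
Unset Strict Implicit.
Unset Printing Implicit Defensive.

Local Open Scope classical_set_scope.
Local Open Scope ring_scope.

(** At the starting point the map X - phi(Y) vanishes, the iterated integral
    against dt is t, and those against the Brownian motions have mean 0.  Hence
    the expectation of the expansion of order 1 is t times the generator L0
    applied to X - phi(Y) ([vexpectation_weak_ito_taylor1]).

    The generator is computed in [L0_gap].  The X-part of the map is linear, so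
    it contributes the drift a and no second derivative; the Y-part contributes
    the first derivative of phi along A and half of its second derivative along
    the diffusion coefficients.  With J the Jacobian matrix of phi at Y0 this is
    v - A(Y0, 0) *m J, where v is a(X0, 0) minus the half second derivative, and
    no other value of A enters.

    So A is a minimizer iff A(Y0, 0) solves the least squares problem of
    approximating v by vectors of the row space of J.  The rows of J are
    independent because phi is an immersion, so the solution is unique and given
    by the normal equations ([least_squares]); its image under J is the
    orthogonal projection of v onto the row space ([orth_proj_row_space]), which
    is the tangent space of M at X0 ([tangentE]).  Applying the inverse of the
    differential of phi to that projection therefore gives the solution back.

    On the probabilistic side, the Riemann sums of the constant 1 telescope, so
    its stochastic integral is almost surely an increment of the integrator
    ([stoch_int_one]); a Brownian increment is integrable of mean 0 because its
    law is a centred normal one ([centred_normal_integrable],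
    [centred_normal_integral]). *)

(** * Least squares *)

Section least_squares.
Context {R : realType}.

Lemma dotE (n : nat) (u v : 'rV[R]_n) : dot u v = (u *m v^T) 0 0.
Proof. by rewrite mxE; apply: eq_bigr => i _; rewrite mxE. Qed.

Lemma dot_ge0 (n : nat) (u : 'rV[R]_n) : 0 <= dot u u.
Proof. by apply: sumr_ge0 => i _; rewrite -expr2 sqr_ge0. Qed.

Lemma dot_eq0 (n : nat) (u : 'rV[R]_n) : dot u u = 0 -> u = 0.
Proof.
move=> /eqP; rewrite psumr_eq0 => [|i _]; last by rewrite -expr2 sqr_ge0.
move=> /allP u0; apply/rowP => i; rewrite mxE; apply/eqP.
by have := u0 i (mem_index_enum _); rewrite /= mulf_eq0 orbb.
Qed.

Lemma enormZ (n : nat) (t : R) (u : 'rV[R]_n) : 0 <= t ->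
  enorm (t *: u) = t * enorm u.
Proof.
move=> t0; rewrite /enorm !dotE linearZ /= -scalemxAl -scalemxAr scalerA mxE.
by rewrite sqrtrM ?mulr_ge0// -expr2 sqrtr_sqr ger0_norm.
Qed.

(** The Moore-Penrose inverse of a matrix with independent rows: row vectors
    act from the left, so w = v *m pinv J solves the normal equations
    w *m (J *m J^T) = v *m J^T. *)
Definition pinv (n r : nat) (J : 'M[R]_(n, r)) : 'M[R]_(r, n) :=
  J^T *m invmx (J *m J^T).

Variables (n r : nat) (J : 'M[R]_(n, r)).
Hypothesis J_inj : forall u : 'rV_n, u *m J = 0 -> u = 0.

(** If u *m J *m J^T = 0, then u *m J is orthogonal to itself. *)
Lemma gram_unit : J *m J^T \in unitmx.
Proof.
rewrite -row_free_unit; apply: inj_row_free => u uJJ; apply/J_inj/dot_eq0.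
by rewrite dotE trmx_mul mulmxA -(mulmxA u) uJJ mul0mx mxE.
Qed.

Lemma mulmx_pinv : J *m pinv J = 1%:M.
Proof. by rewrite mulmxA mulmxV ?gram_unit. Qed.

Lemma residual_orthogonal (v : 'rV_r) : (v - v *m pinv J *m J) *m J^T = 0.
Proof.
by rewrite mulmxBl -!mulmxA mulVmx ?gram_unit// mulmx1 subrr.
Qed.

Lemma orth_proj_row_space (v : 'rV_r) :
  orth_proj (range (mulmx^~ J : 'rV_n -> 'rV_r)) v = v *m pinv J *m J.
Proof.
rewrite /orth_proj.
case: xgetP => [p _ [[u _ <-{p}] /= up]|/(_ (v *m pinv J *m J)) H].
  have vu : (v - u *m J) *m J^T = 0.
    (* test orthogonality against the image under J of this very vector *)
    have := up _ (imageT _ ((v - u *m J) *m J^T)).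
    by rewrite dotE /= (trmx_mul _ J) mulmxA -dotE => /dot_eq0.
  have /eqP := vu; rewrite mulmxBl subr_eq0 => /eqP vu'.
  by rewrite /pinv mulmxA vu' -(mulmxA u) mulmxK ?gram_unit.
exfalso; apply: H; split; first by exists (v *m pinv J).
move=> _ [u _ <-].
by rewrite dotE trmx_mul mulmxA residual_orthogonal mul0mx mxE.
Qed.

(** Pythagoras: the residual of v *m pinv J is orthogonal to the row space, so
    any other w' adds the squared norm of (v *m pinv J - w') *m J. *)
Lemma least_squares (v : 'rV_r) (w : 'rV_n) :
  (forall w', enorm (v - w *m J) <= enorm (v - w' *m J)) <-> w = v *m pinv J.
Proof.
have pyth w' : dot (v - w' *m J) (v - w' *m J) =
    dot (v - v *m pinv J *m J) (v - v *m pinv J *m J)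
    + dot ((v *m pinv J - w') *m J) ((v *m pinv J - w') *m J).
  rewrite -[v - w' *m J](subrKA (v *m pinv J *m J)) -mulmxBl.
  set a := v - _; set b := v *m _ - _.
  have aJ : a *m J^T = 0 := residual_orthogonal v.
  rewrite !dotE linearD /= mulmxDl !mulmxDr trmx_mul !mulmxA aJ mul0mx addr0.
  have -> : b *m J *m a^T = (a *m J^T *m b^T)^T.
    by rewrite !trmx_mul !trmxK mulmxA.
  by rewrite aJ mul0mx trmx0 add0r mxE.
split=> [|->] => [min_w|w'].
  have := min_w (v *m pinv J).
  rewrite /enorm ler_sqrt ?dot_ge0// pyth gerDl => b0.
  have /J_inj/eqP := dot_eq0 (le_anti (introT andP (conj b0 (dot_ge0 _)))).
  by rewrite subr_eq0 => /eqP ->.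
by rewrite /enorm ler_sqrt ?dot_ge0// (pyth w') lerDl dot_ge0.
Qed.

End least_squares.

(** * The tangent space in a chart *)

Section tangent_space.
Context {R : realType}.

Lemma mulmx_bounded (n r : nat) (M : 'M[R]_(n, r)) :
  exists2 K : R, 0 < K & forall u : 'rV_n, `|u *m M| <= K * `|u|.
Proof.
(* the 1 keeps K positive when M = 0 *)
pose K := 1 + \sum_j \sum_i `|M i j|.
have S0 : 0 <= \sum_j \sum_i `|M i j|.
  by apply: sumr_ge0 => j _; exact: sumr_ge0.
have K0 : 0 < K by rewrite ltr_pwDl.
exists K => // u; rewrite [leLHS]/Num.norm/= mx_normrE.
apply/bigmax_leP; split=> [|[i j] _ /=]; first by rewrite mulr_ge0// ltW.
rewrite mxE (le_trans (ler_norm_sum _ _ _))//.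
apply: (@le_trans _ _ ((\sum_k `|M k j|) * `|u|)).
  rewrite mulr_suml; apply: ler_sum => k _; rewrite normrM mulrC ler_wpM2l//.
  by rewrite [leRHS]/Num.norm/= mx_normrE; exact: (le_bigmax _ _ (i, k)).
rewrite ler_wpM2r// /K (bigD1 j)//= addrCA lerDl addr_ge0// sumr_ge0// => k _.
exact: sumr_ge0.
Qed.

Lemma differentiable_near (V W : normedModType R) (f : V -> W) (y : V) (e : R) :
  0 < e -> differentiable f y ->
  \forall z \near y, `|f z - f y - 'd f y (z - y)| <= e * `|z - y|.
Proof.
move=> e0 /diff_locallyx df.
have : \forall h \near (0 : V), `|f (h + y) - f y - 'd f y h| <= e * `|h|.
  near=> h; rewrite df -addrA -opprD addrAC subrr add0r.
  by near: h; apply: littleoP.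
rewrite (near_shift y) sub0r; apply: filterS => z /=.
by rewrite subrK.
Unshelve. all: by end_near. Qed.

Variables (r n : nat) (M U : set 'rV[R]_r).
Variables (psi : 'rV[R]_r -> 'rV[R]_n) (phi : 'rV[R]_n -> 'rV[R]_r).
Hypothesis hchart : chart M U psi phi.
Variable x : 'rV[R]_r.
Hypothesis Ux : U x.

Let y := psi x.

Lemma chart_phiK : phi y = x.
Proof. by case: hchart => _ _ _ /(_ x) -> //; rewrite inE. Qed.

Lemma chart_near_range : \forall z \near y, (psi @` U) z.
Proof.
by case: hchart => _ oU _ _ _; apply: open_nbhs_nbhs; split => //; exists x.
Qed.

Lemma chart_differentiable : \forall z \near y, differentiable phi z.
Proof.
case: hchart => _ _ _ _ [/(_ 1%N) [dphi _] _].
by apply: filterS chart_near_range => z; exact: dphi.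
Qed.

Lemma chart_jacobian_inj (u : 'rV_n) : u *m jacobian phi y = 0 -> u = 0.
Proof.
case: hchart => _ _ _ _ [_ inj]; rewrite mul_rV_lin1 => du.
by apply: (inj y); [exists x|rewrite du linear0].
Qed.

(** The curve s |-> phi (y + s w) stays in U for small s because psi(U) is
    open. *)
Lemma tangent_of_range (w : 'rV_n) : tangent M x (w *m jacobian phi y).
Proof.
have dphi : differentiable phi y := nbhs_singleton chart_differentiable.
exists (fun s : R => phi (s *: w + y)); split.
- by rewrite scale0r add0r chart_phiK.
- have : s *: w + y @[s --> (0 : R)] --> (0 : R) *: w + y.
    by apply: cvgD; [apply: cvgZr_tmp; exact: cvg_id|exact: cvg_cst].
  rewrite scale0r add0r.
  move=> /(_ _ chart_near_range) near_range.
  have : \forall s \near (0 : R), (psi @` U) (s *: w + y) := near_range.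
  apply: filterS => s [u Uu /= <-].
  case: hchart => [[D _ UE] _ _ psiK _].
  by rewrite psiK ?inE//; move: Uu; rewrite UE => -[].
- have qE :
      (fun h : R => h^-1 *: (phi ((h *: 1 + 0) *: w + y) - phi (0 *: w + y)))
      = (fun h => h^-1 *: (phi (h *: w + y) - phi y)).
    apply/funext => h; rewrite scale0r add0r.
    by rewrite (_ : h *: 1 + 0 = h) // addr0 [LHS]mulr1.
  have dw : derivable phi y w := diff_derivable dphi.
  apply: DeriveDef; first by rewrite /derivable /= qE.
  by rewrite /derive /= qE -[LHS]/('D_w phi y) deriveEjacobian.
Qed.

(** Read in the chart, a differentiable curve gamma in M through x is
    phi (y + u) with u -> 0, so gamma - x = u *m J + o(u).  A left inverse of
    the injective u |-> u *m J shows that u = O(gamma - x) = O(h), hence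
    gamma - x is within o(h) of the row space of J.  The matrix Q below
    annihilates that row space, so Q annihilates the velocity v. *)
Lemma range_of_tangent (v : 'rV_r) : tangent M x v ->
  v = v *m pinv (jacobian phi y) *m jacobian phi y.
Proof.
move=> [gamma [gamma0 gammaM dgamma]].
set J := jacobian phi y; set G := pinv J.
have JG : J *m G = 1%:M := mulmx_pinv chart_jacobian_inj.
pose Q := 1%:M - G *m J.
have JQ : J *m Q = 0 by rewrite mulmxBr mulmx1 mulmxA JG mul1mx subrr.
suff vQ : v *m Q = 0.
  by apply/eqP; rewrite -subr_eq0 -mulmxA -[X in X - _]mulmx1 -mulmxBr vQ.
have [KG KG0 KGP] := mulmx_bounded G; have [KQ KQ0 KQP] := mulmx_bounded Q.
have dphi : differentiable phi y := nbhs_singleton chart_differentiable.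
pose q (h : R) := h^-1 *: (gamma h - x).
have qv : q h @[h --> 0^'] --> v.
  have [dg <-] := dgamma.
  have -> : q = fun h => h^-1 *: (gamma (h *: 1 + 0) - gamma 0).
    apply/funext => h; rewrite gamma0 /q (_ : h *: 1 + 0 = h)//.
    by rewrite addr0 [LHS]mulr1.
  exact: dg.
have gammax : gamma h @[h --> (0 : R)] --> x.
  rewrite -[X in _ --> X]gamma0; apply: differentiable_continuous.
  by apply/derivable1_diffP; case: dgamma.
have gammaU : \forall h \near (0 : R), U (gamma h).
  case: hchart => [[D oD UE] _ _ _ _].
  have Dx : D x by move: Ux; rewrite UE => -[].
  have gammaD : \forall h \near (0 : R), D (gamma h).
    by apply: gammax; exact: open_nbhs_nbhs.
  by apply: filterS2 gammaM gammaD => h; rewrite UE.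
have gammay : psi (gamma h) @[h --> (0 : R)] --> y.
  case: hchart => _ _ /subspace_continuousP /(_ x Ux) psix _ _ B /psix psiB.
  have : \forall h \near (0 : R), U (gamma h) -> B (psi (gamma h)).
    exact: gammax psiB.
  by apply: filterS2 gammaU => h Uh; apply.
apply/eqP; rewrite -normr_le0; apply/ler_addgt0Pr => e e0; rewrite add0r.
(* |v Q| is at most KQ |v - q h| + |q h Q|; the first term is at most KQ eps,
   the second one at most KQ eps (2 KG (|v| + 1)), whence C.  The bound
   eps <= 1 / (2 KG) absorbs the o(u) term into u, and eps <= 1 gives
   |q h| <= |v| + 1. *)
pose C := KQ * (1 + 2 * KG * (`|v| + 1)).
have C0 : 0 < C by rewrite mulr_gt0// ltr_pwDl// !mulr_ge0// ?addr_ge0// ltW.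
pose eps := Num.min (e / C) (Num.min (2 * KG)^-1 1).
have eps0 : 0 < eps.
  by rewrite !lt_min ltr01 divr_gt0//= invr_gt0 mulr_gt0.
have epsC : eps <= e / C by rewrite ge_min lexx.
have epsG : eps <= (2 * KG)^-1 by rewrite !ge_min lexx orbT.
have eps1 : eps <= 1 by rewrite !ge_min lexx !orbT.
have H1 : \forall h \near (0 : R)^', `|v - q h| <= eps.
  by have /cvgrPdist_le := qv; apply.
have H2 : \forall h \near (0 : R)^', U (gamma h).
  exact: nbhs_dnbhs.
have H3 : \forall h \near (0 : R)^',
    `|phi (psi (gamma h)) - phi y - 'd phi y (psi (gamma h) - y)|
      <= eps * `|psi (gamma h) - y|.
  by apply: nbhs_dnbhs; exact: gammay (differentiable_near eps0 dphi).
near (0 : R)^' => h.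
have qvh : `|v - q h| <= eps by near: h.
have Uh : U (gamma h) by near: h.
have : `|phi (psi (gamma h)) - phi y - 'd phi y (psi (gamma h) - y)|
      <= eps * `|psi (gamma h) - y| by near: h.
have psiK : phi (psi (gamma h)) = gamma h.
  by case: hchart => _ _ _ /(_ (gamma h)) -> //; rewrite inE.
rewrite psiK chart_phiK -['d phi y _]mul_rV_lin1 -/(jacobian phi y) -/J.
set u := psi (gamma h) - y; set g := gamma h - x => gu.
have uE : u = g *m G - (g - u *m J) *m G.
  by rewrite [(g - _) *m G]mulmxBl opprB addrC subrK -mulmxA JG mulmx1.
have nu : `|u| <= 2 * KG * `|g|.
  have : `|u| <= KG * `|g| + KG * (eps * `|u|).
    rewrite {1}uE (le_trans (ler_normB _ _))// lerD ?KGP// (le_trans (KGP _))//.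
    by rewrite ler_pM2l.
  have : KG * (eps * `|u|) <= `|u| / 2.
    rewrite mulrA mulrC ler_wpM2l// -ler_pdivlMl//.
    by rewrite (le_trans epsG)// invfM mulrC.
  lra.
have gQ : g *m Q = (g - u *m J) *m Q.
  by rewrite [RHS]mulmxBl -mulmxA JQ mulmx0 subr0.
have ngQ : `|g *m Q| <= KQ * (eps * (2 * KG * `|g|)).
  rewrite gQ (le_trans (KQP _))// ler_pM2l// (le_trans gu)//.
  by rewrite ler_pM2l.
have nqQ : `|q h *m Q| <= KQ * (eps * (2 * KG * `|q h|)).
  rewrite /q -scalemxAl !normrZ.
  have := ler_wpM2l (normr_ge0 h^-1) ngQ; congr (_ <= _); ring.
have nq : `|q h| <= `|v| + 1.
  rewrite -[q h](subKr v) (le_trans (ler_normB _ _))// lerD2l (le_trans qvh)//.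
rewrite -[v](subrK (q h)) mulmxDl (le_trans (ler_normD _ _))//.
apply: (@le_trans _ _ (eps * C)); last by rewrite -ler_pdivlMr.
have -> : eps * C = KQ * eps + KQ * (eps * (2 * KG * (`|v| + 1))).
  by rewrite /C; ring.
rewrite lerD//; first by rewrite (le_trans (KQP _))// ler_pM2l.
by rewrite (le_trans nqQ)// ler_pM2l// ler_pM2l// ler_pM2l// mulr_gt0.
Unshelve. all: by end_near. Qed.

Lemma tangentE :
  tangent M x = range (mulmx^~ (jacobian phi y) : 'rV_n -> 'rV_r).
Proof.
apply/seteqP; split => [v /range_of_tangent -> //|_ [w _ <-]].
exact: tangent_of_range.
Qed.
End tangent_space.

(** * The generator of the difference X - phi(Y) *)

Section stacked_variables.
Context {R : realType} {V : normedModType R} {r n : nat}.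
Implicit Types z v : 'rV[R]_(r + n).

(** The difference quotients of both sides are the same functions. *)
Lemma derivable_rsubmx (g : 'rV[R]_n -> V) z v :
  derivable g (rsubmx z) (rsubmx v) -> derivable (fun z => g (rsubmx z)) z v.
Proof.
rewrite /derivable; set q := (X in cvg (X @ _)).
set q' := (X in _ -> cvg (X @ _)).
by have -> : q = q' by apply/funext => h; rewrite /q /q' /= linearP.
Qed.

Lemma derive_rsubmx (g : 'rV[R]_n -> V) z v :
  'D_v (fun z => g (rsubmx z)) z = 'D_(rsubmx v) g (rsubmx z).
Proof.
rewrite /derive; set q := (X in lim (X @ _)); set q' := (X in _ = lim (X @ _)).
by have -> : q = q' by apply/funext => h; rewrite /q /q' /= linearP.
Qed.

Lemma derive_lsubmx z v : 'D_v (fun z => lsubmx z : 'rV[R]_r) z = lsubmx v.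
Proof.
rewrite -[RHS](derive_id (lsubmx z)) /derive.
set q := (X in lim (X @ _)); set q' := (X in _ = lim (X @ _)).
by have -> : q = q' by apply/funext => h; rewrite /q /q' /= linearP.
Qed.

Lemma rsubmx_delta_lshift i :
  rsubmx (delta_mx 0 (lshift n i) : 'rV[R]_(r + n)) = 0.
Proof. by apply/rowP => j; rewrite !mxE eq_rlshift andbF. Qed.

Lemma rsubmx_delta_rshift j :
  rsubmx (delta_mx 0 (rshift r j) : 'rV[R]_(r + n)) = delta_mx 0 j.
Proof. by apply/rowP => k; rewrite !mxE eq_rshift. Qed.

Lemma lsubmx_delta_lshift i :
  lsubmx (delta_mx 0 (lshift n i) : 'rV[R]_(r + n)) = delta_mx 0 i.
Proof. by apply/rowP => k; rewrite !mxE eq_lshift. Qed.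

Lemma lsubmx_delta_rshift j :
  lsubmx (delta_mx 0 (rshift r j) : 'rV[R]_(r + n)) = 0.
Proof. by apply/rowP => k; rewrite !mxE eq_lrshift andbF. Qed.

End stacked_variables.

Section generator_of_gap.
Context {R : realType} {r n m : nat}.
Variable phi : 'rV[R]_n -> 'rV[R]_r.

Let gap (z : 'rV[R]_(r + n)) := lsubmx z - phi (rsubmx z).

Lemma derive_gap (z v : 'rV[R]_(r + n)) :
  derivable phi (rsubmx z) (rsubmx v) ->
  'D_v gap z = lsubmx v - 'D_(rsubmx v) phi (rsubmx z).
Proof.
move=> dphi; rewrite deriveB; last exact: derivable_rsubmx.
  by rewrite derive_lsubmx derive_rsubmx.
exact/diff_derivable/differentiable_lsubmx.
Qed.

Lemma partial_gap_lshift i z : partial (lshift n i) gap z = delta_mx 0 i.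
Proof.
rewrite /partial derive_gap rsubmx_delta_lshift; last exact: derivable0.
by rewrite derive0 subr0 lsubmx_delta_lshift.
Qed.

Lemma partial_gap_rshift j z : differentiable phi (rsubmx z) ->
  partial (rshift r j) gap z = - partial j phi (rsubmx z).
Proof.
move=> dphi; rewrite /partial derive_gap; last exact: diff_derivable.
by rewrite lsubmx_delta_rshift rsubmx_delta_rshift sub0r.
Qed.

Lemma partial2_gap_lshift k i z :
  partial k (partial (lshift n i) gap) z = 0.
Proof.
rewrite (_ : partial (lshift n i) gap = cst (delta_mx 0 i)).
  by rewrite /partial derive_cst.
by apply/funext => z'; exact: partial_gap_lshift.
Qed.

Variables (x : 'rV[R]_r) (y : 'rV[R]_n).
Hypothesis dphi : \forall y' \near y, differentiable phi y'.
Hypothesis d2phi : forall j, differentiable (partial j phi) y.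

(** The second derivative sees [partial_gap_rshift] on a whole neighbourhood of
    the point, which is why phi is differentiable near y and not only at y. *)
Lemma partial2_gap_rshift j v :
  'D_v (partial (rshift r j) gap) (row_mx x y) =
  - 'D_(rsubmx v) (partial j phi) y.
Proof.
have near_gap : \forall z \near row_mx x y,
    partial (rshift r j) gap z = - partial j phi (rsubmx z).
  have cr : {for row_mx x y, continuous (@rsubmx R 1 r n)}.
    exact/differentiable_continuous/differentiable_rsubmx.
  have : \forall z \near row_mx x y, differentiable phi (rsubmx z).
    by apply: (cr (fun y' => differentiable phi y')); rewrite row_mxKr.
  by apply: filterS => z; exact: partial_gap_rshift.
rewrite (near_eq_derive _ near_gap) deriveN ?derive_rsubmx ?row_mxKr//.
by apply: derivable_rsubmx; rewrite row_mxKr; exact: diff_derivable.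
Qed.

(** Only the pairs of two Y-coordinates contribute to the second order term. *)
Lemma L0_gap (Sx : sde R r m) (Sy : sde R n m) (t : R) :
  L0 (stack Sx Sy) (fun z _ => lsubmx z - phi (rsubmx z)) (row_mx x y) t =
  drift Sx x t
  - 2^-1 *: (\sum_alpha \sum_beta gE R alpha beta *:
       nabla_diff phi y (diffusion Sy alpha y t) (diffusion Sy beta y t))
  - drift Sy y t *m jacobian phi y.
Proof.
rewrite /L0 -/gap /= derive1_cst add0r row_mxKl row_mxKr.
have -> : \sum_i row_mx (drift Sx x t) (drift Sy y t) 0 i
      *: partial i gap (row_mx x y) =
    drift Sx x t - drift Sy y t *m jacobian phi y.
  rewrite big_split_ord /=; congr (_ + _).
    rewrite [RHS]row_sum_delta; apply: eq_bigr => i _.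
    by rewrite row_mxEl partial_gap_lshift.
  rewrite mulmx_sum_row -sumrN; apply: eq_bigr => j _.
  have dy := nbhs_singleton dphi.
  rewrite row_mxEr partial_gap_rshift row_mxKr// scalerN /partial.
  by rewrite deriveEjacobian// rowE.
rewrite addrAC; congr (_ + _ - _); rewrite -scalerN; congr (_ *: _).
rewrite big_split_ord /= big1 => [|i _]; last first.
  rewrite big_split_ord /= !big1 ?addr0// => j _.
    rewrite big1// => alpha _; rewrite big1// => beta _.
    rewrite [X in _ *: X]partial2_gap_rshift rsubmx_delta_lshift derive0.
    by rewrite oppr0 scaler0.
  rewrite big1// => alpha _; rewrite big1// => beta _.
  by rewrite partial2_gap_lshift scaler0.
rewrite add0r.
transitivity (\sum_(i < n) \sum_(j < n) \sum_alpha \sum_beta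
    gE R alpha beta *: ((diffusion Sy alpha y t 0 i * diffusion Sy beta y t 0 j)
      *: - partial i (partial j phi) y)).
  apply: eq_bigr => i _; rewrite big_split_ord /= big1 ?add0r; last first.
    move=> j _; rewrite big1// => alpha _; rewrite big1// => beta _.
    by rewrite partial2_gap_lshift scaler0.
  apply: eq_bigr => j _; apply: eq_bigr => alpha _; apply: eq_bigr => beta _.
  rewrite [X in _ *: X = _]partial2_gap_rshift rsubmx_delta_rshift !row_mxEr.
  by rewrite scalerA mulrC.
rewrite -sumrN.
under eq_bigr do rewrite exchange_big.
rewrite exchange_big; apply: eq_bigr => alpha _.
under eq_bigr do rewrite exchange_big.
rewrite exchange_big -sumrN; apply: eq_bigr => beta _.
rewrite /nabla_diff scaler_sumr -sumrN; apply: eq_bigr => i _.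
rewrite scaler_sumr -sumrN; apply: eq_bigr => j _.
by rewrite !scalerN.
Qed.
End generator_of_gap.

(** * Centred normal laws *)

Section normal.
Context {R : realType}.
Notation mu := (@lebesgue_measure R).

(** Radon-Nikodym derivatives are unique almost everywhere, so the abstract one
    of [normal_prob] can be replaced by [normal_pdf]. *)
Lemma ge0_integral_normal_prob (m s : R) (f : R -> \bar R) :
  measurable_fun setT f -> (forall x, 0 <= f x)%E ->
  (\int[normal_prob m s]_x f x = \int[mu]_x (f x * (normal_pdf m s x)%:E))%E.
Proof.
move=> mf f0; have numu := normal_prob_dominates m s.
rewrite -(Radon_Nikodym_SigmaFinite.change_of_variables numu)//.
have fi := Radon_Nikodym_SigmaFinite.f_integrable numu.
apply: ae_eq_integral => //.
- by apply: emeasurable_funM => //; exact: (measurable_int mu).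
- apply: emeasurable_funM => //.
  by apply/measurable_EFinP; exact: measurable_normal_pdf.
- apply: ae_eqe_mul2l; apply: integral_ae_eq => //.
    by apply/measurable_EFinP; exact: measurable_normal_pdf.
  move=> E _ mE.
  by rewrite -Radon_Nikodym_SigmaFinite.f_integral.
Qed.

(** The factor |x| costs only a widening of the Gaussian: it is at most a
    constant times exp (k x^2), which turns the density of standard deviation s
    into a multiple of that of standard deviation 2 s, whose integral is 1. *)
Lemma normal_first_moment_lty (s : R) : s != 0 ->
  (\int[mu]_x (`|x| * normal_pdf 0 s x)%:E < +oo)%E.
Proof.
move=> s0.
have s2 : 0 < s ^+ 2 by rewrite exprn_even_gt0.
(* 1 / (2 s^2) = 1 / (2 (2 s)^2) + k *)
have [k kE] : exists k : R, k = 3 / (8 * s ^+ 2) by eexists.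
have k0 : 0 < k by rewrite kE divr_gt0// mulr_gt0.
(* |x| <= 1 + x^2 <= (1 + 1 / k) (1 + k x^2) <= (1 + 1 / k) exp (k x^2) *)
pose C := (1 + k^-1) * (normal_peak s / normal_peak (2 * s)).
have s20 : 2 * s != 0 by rewrite mulf_neq0.
have p1 := normal_peak_gt0 s0; have p2 := normal_peak_gt0 s20.
have C0 : 0 <= C.
  by rewrite mulr_ge0 ?addr_ge0 ?invr_ge0 ?(ltW k0)// divr_ge0// ltW.
apply: (@le_lt_trans _ _ (\int[mu]_x (C%:E * (normal_pdf 0 (2 * s) x)%:E))%E).
  apply: ge0_le_integral => //=.
  - by move=> x _; rewrite lee_fin mulr_ge0// normal_pdf_ge0.
  - apply/measurable_EFinP/measurable_funM => //.
    exact: measurable_normal_pdf.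
  - apply/measurable_EFinP/measurable_funM => //.
    exact: measurable_normal_pdf.
  - move=> x _; rewrite -EFinM lee_fin !normal_pdfE// /normal_fun !subr0.
    have -> : C * (normal_peak (2 * s) *
        expR (- x ^+ 2 / ((2 * s) ^+ 2 *+ 2))) =
      normal_peak s * ((1 + k^-1) * expR (- x ^+ 2 / ((2 * s) ^+ 2 *+ 2))).
      by rewrite /C; field; rewrite !gt_eqF.
    rewrite mulrCA ler_wpM2l ?(ltW p1)//.
    have -> : - x ^+ 2 / ((2 * s) ^+ 2 *+ 2) =
        k * x ^+ 2 + - x ^+ 2 / (s ^+ 2 *+ 2).
      by rewrite kE; field; rewrite s0.
    rewrite expRD mulrA ler_wpM2r ?expR_ge0//.
    apply: (@le_trans _ _ ((1 + k^-1) * (1 + k * x ^+ 2))).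
      have -> : (1 + k^-1) * (1 + k * x ^+ 2) =
        1 + k * x ^+ 2 + k^-1 + x ^+ 2 by field; rewrite gt_eqF.
      have : 0 < k^-1 by rewrite invr_gt0.
      have := mulr_ge0 (ltW k0) (sqr_ge0 x).
      rewrite -(real_normK (num_real x)).
      have := sqr_ge0 (`|x| - 1); have := normr_ge0 x; set y := `|x|.
      nra.
    rewrite ler_wpM2l ?addr_ge0 ?invr_ge0 ?(ltW k0)//.
    exact: expR_ge1Dx.
rewrite ge0_integralZl//=.
- by rewrite integral_normal_pdf mule1 ltry.
- by apply/measurable_EFinP; exact: measurable_normal_pdf.
- by move=> x _; rewrite lee_fin normal_pdf_ge0.
Qed.

Lemma normal_pdfN (s x : R) : s != 0 ->
  normal_pdf 0 s (- x) = normal_pdf 0 s x.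
Proof. by move=> s0; rewrite !normal_pdfE// /normal_fun !subr0 sqrrN. Qed.

(** The reflection x |-> - x exchanges the two integrals; each integrand is
    supported on a half-line, where the substitution formula applies. *)
Lemma normal_half_moments (s : R) : s != 0 ->
  (\int[mu]_x (Num.max x 0 * normal_pdf 0 s x)%:E =
   \int[mu]_x (Num.max (- x) 0 * normal_pdf 0 s x)%:E)%E.
Proof.
move=> s0.
have cG : continuous (fun x : R => Num.max (- x) 0 * normal_pdf 0 s x).
  move=> x; apply: cvgM; last exact: continuous_normal_pdf.
  apply: (@continuous_max _ _ (fun x => - x) (cst 0)); last exact: cvg_cst.
  exact: opp_continuous.
have -> : (fun x : R => (Num.max (- x) 0 * normal_pdf 0 s x)%:E) =
  (fun x : R => (Num.max (- x) 0 * normal_pdf 0 s x)%:E) \_ `]-oo, (- 0)%R].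
  apply/funext => x; rewrite patchE; case: ifPn => //.
  rewrite notin_setE/= in_itv/= oppr0 => /negP; rewrite -ltNge => x0.
  by rewrite max_r ?mul0r// oppr_le0 ltW.
rewrite -integral_mkcond ge0_integration_by_substitutionNy; last first.
- by move=> x _; rewrite mulr_ge0 ?normal_pdf_ge0// le_max lexx orbT.
- exact: continuous_subspaceT.
rewrite [RHS]integral_mkcond; apply: eq_integral => x _.
rewrite patchE; case: ifPn => [_|].
  by rewrite /= opprK normal_pdfN.
rewrite notin_setE/= in_itv/= andbT => /negP; rewrite -ltNge => x0.
by rewrite max_r ?mul0r// ltW.
Qed.
End normal.

Section centred_normal.
Context {d : measure_display} {T : measurableType d} {R : realType}.
Variable P : probability T R.

Lemma ge0_integral_normal_law (m s : R) (X : {RV P >-> R}) (f : R -> \bar R) :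
  (forall B, measurable B -> P (X @^-1` B) = normal_prob m s B) ->
  measurable_fun setT f -> (forall x, 0 <= f x)%E ->
  (\int[P]_w f (X w) =
   \int[lebesgue_measure]_x (f x * (normal_pdf m s x)%:E))%E.
Proof.
move=> lawX mf f0; rewrite -ge0_integral_normal_prob//.
(* [normal_prob] lives on [measurableTypeR R], whose display differs from that
   of R as a measurable type, although the measurable sets are the same. *)
pose mX : @measurable_fun _ _ T (measurableTypeR R) setT X :=
  @measurable_funPT _ _ _ _ X.
pose X' : {RV P >-> measurableTypeR R} :=
  HB.pack (X : T -> measurableTypeR R) (isMeasurableFun.Build _ _ _ _ _ mX).
rewrite -[LHS](@ge0_integral_distribution _ _ _ (measurableTypeR R) _ P X' f)//.
by apply: eq_measure_integral => A mA _; exact: lawX.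
Qed.

Lemma centred_normal_integrable (s : R) (X : {RV P >-> R}) : s != 0 ->
  (forall B, measurable B -> P (X @^-1` B) = normal_prob 0 s B) ->
  P.-integrable setT (EFin \o (X : T -> R)).
Proof.
move=> s0 lawX; apply/integrableP; split.
  exact/measurable_EFinP/measurable_funPT.
rewrite (ge0_integral_normal_law (f := fun x => `|x%:E|%E) lawX)//=.
- under eq_integral do rewrite -EFinM.
  exact: normal_first_moment_lty.
- exact: measurableT_comp.
Qed.

Lemma centred_normal_integral (s : R) (X : {RV P >-> R}) : s != 0 ->
  (forall B, measurable B -> P (X @^-1` B) = normal_prob 0 s B) ->
  (\int[P]_w (X w)%:E = 0)%E.
Proof.
move=> s0 lawX.
have iX := centred_normal_integrable s0 lawX.
have gh : (\int[P]_w (Num.max (X w) 0)%:E =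
           \int[P]_w (Num.max (- X w) 0)%:E)%E.
  rewrite (ge0_integral_normal_law (f := fun x : R => (Num.max x 0)%:E) lawX);
    last 2 first.
  - by apply/measurable_EFinP; exact: (@measurable_maxr _ _ _ setT).
  - by move=> x; rewrite lee_fin le_max lexx orbT.
  rewrite (ge0_integral_normal_law (f := fun x : R => (Num.max (- x) 0)%:E)
    lawX); last 2 first.
  - by apply/measurable_EFinP; exact: (@measurable_maxr _ _ _ setT).
  - by move=> x; rewrite lee_fin le_max lexx orbT.
  under eq_integral do rewrite -EFinM.
  under [RHS]eq_integral do rewrite -EFinM.
  exact: normal_half_moments.
have pE w : ((EFin \o X)^\+ w = (Num.max (X w) 0)%:E)%E.
  by rewrite funeposE -EFin_max.
have nE w : ((EFin \o X)^\- w = (Num.max (- X w) 0)%:E)%E.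
  by rewrite funenegE -EFin_max.
rewrite integralE.
under [X in (_ - X)%E]eq_integral do rewrite nE.
rewrite -gh.
under [X in (_ - X)%E]eq_integral do rewrite -pE.
by rewrite subee//; apply: integrable_fin_num => //; exact: integrable_funepos.
Qed.

End centred_normal.

(** * Stochastic integrals of the constant 1 *)

Section stochastic_integral_of_one.
Context {d : measure_display} {T : measurableType d} {R : realType}.
Variable P : probability T R.

Lemma subdivision_exists (t1 t2 delta : R) : t1 <= t2 -> 0 < delta ->
  exists K u, subdivision t1 t2 delta K u.
Proof.
move=> t12 delta0.
pose K := (Num.truncn ((t2 - t1) / delta)).+1.
exists K, (fun k => t1 + k%:R * ((t2 - t1) / K%:R)).
have K0 : 0 < K%:R :> R by rewrite ltr0n.
split.
- by rewrite mul0r addr0.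
- by rewrite mulrC divfK ?gt_eqF// addrC subrK.
- move=> k _; rewrite lerD2l ler_wpM2r ?ler_nat//; last first.
    by rewrite divr_ge0 ?subr_ge0// ltW.
  split => //; rewrite -natr1 (_ : _ - _ = (t2 - t1) / K%:R); last by ring.
  by rewrite ltr_pdivrMr// mulrC -ltr_pdivrMr// truncnS_gt.
Qed.

Lemma riemann_sum_one (V : R -> T -> R) K u w :
  riemann_sum (fun _ _ => 1) V K u w = V (u K) w - V (u 0%N) w.
Proof.
rewrite /riemann_sum; under eq_bigr do rewrite mul1r.
rewrite -(big_mkord predT (fun k => V (u k.+1) w - V (u k) w)).
by rewrite telescope_sumr.
Qed.

(** Uniqueness of limits in probability: the events increase as e decreases, so
    each of them has probability at most every smaller e. *)
Lemma ae_eq_of_prob_small (J J' : T -> R) :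
  measurable_fun setT J -> measurable_fun setT J' ->
  (forall e : R, 0 < e -> (P [set w | (e <= `|J w - J' w|)%R] <= e%:E)%E) ->
  ae_eq P setT J J'.
Proof.
move=> mJ mJ' JJ'.
have mS e : measurable [set w | e <= `|J w - J' w|].
  rewrite -[X in measurable X]setTI; apply: measurable_fun_le => //.
  by apply: measurableT_comp => //; exact: measurable_funB.
have null e : 0 < e -> P [set w | e <= `|J w - J' w|] = 0%E.
  move=> e0; apply/eqP; rewrite eq_le measure_ge0 andbT.
  apply/lee_addgt0Pr => x x0; rewrite add0e.
  apply: (@le_trans _ _ (P [set w | Num.min x e <= `|J w - J' w|])).
    apply: le_measure; rewrite ?inE// => w /=; apply: le_trans.
    by rewrite ge_min lexx orbT.
  apply: le_trans (JJ' _ _) _; first by rewrite lt_min x0.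
  by rewrite lee_fin ge_min lexx.
apply: (@negligibleS _ _ _ _
  (\bigcup_n [set w | n.+1%:R^-1 <= `|J w - J' w|])).
  move=> w /= /not_implyP[_ /eqP JJw].
  have D0 : 0 < `|J w - J' w| by rewrite normr_gt0 subr_eq0.
  exists (Num.truncn (`|J w - J' w|^-1)) => //=.
  by rewrite -[leRHS]invrK lef_pV2 ?posrE ?invr_gt0// ltW// truncnS_gt.
by apply: negligible_bigcup => n; apply/negligibleP; [exact: mS|exact: null].
Qed.

(** Every Riemann sum of the constant 1 telescopes to the increment of the
    integrator, which is therefore a limit in probability; the version chosen by
    [stoch_int] agrees with it almost surely. *)
Lemma stoch_int_one (V : R -> T -> R) (t1 t2 : R) : t1 <= t2 ->
  measurable_fun setT (V t1) -> measurable_fun setT (V t2) ->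
  measurable_fun setT (stoch_int P (fun _ _ => 1) V t1 t2) /\
  ae_eq P setT (stoch_int P (fun _ _ => 1) V t1 t2) (V t2 \- V t1).
Proof.
move=> t12 mV1 mV2; rewrite /stoch_int.
set S := (X in xget _ X).
have SV : S (V t2 \- V t1).
  split; first exact: measurable_funB.
  move=> e e0; exists 1 => // K u [u0 uK _].
  rewrite (_ : [set w | _] = set0) ?measure0 ?lee_fin ?ltW//.
  rewrite -subset0 => w /=.
  by rewrite riemann_sum_one u0 uK subrr normr0 leNgt e0.
have [mJ JV] := xgetI (cst 0) SV.
split => //; apply: ae_eq_of_prob_small => //; first exact: measurable_funB.
move=> e /JV[delta delta0 /(_ _ _) H].
have [K [u Ku]] := subdivision_exists t12 delta0.
have := H _ _ Ku; congr (P _ <= _)%E.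
case: Ku => u0 uK _.
by apply/seteqP; split => w /=; rewrite riemann_sum_one u0 uK.
Qed.
End stochastic_integral_of_one.

(** * The expansion of order 1 *)

Section expansion_of_order_one.
Context {d : measure_display} {T : measurableType d} {R : realType}.
Variable P : probability T R.

Lemma ae_eq_integrable (f g : T -> \bar R) : measurable_fun setT g ->
  ae_eq P setT f g -> P.-integrable setT f ->
  P.-integrable setT g /\ (\int[P]_w g w = \int[P]_w f w)%E.
Proof.
move=> mg fg /integrableP[mf foo]; split; last first.
  by apply: ae_eq_integral => //; exact: ae_eq_sym.
apply/integrableP; split => //; apply: le_lt_trans foo.
rewrite le_eqVlt; apply/orP; left; apply/eqP.
apply: ae_eq_integral => //; [exact: measurableT_comp..|].
by apply: filterS fg => w H /H ->.
Qed.

(** The multi-indices of length at most 1 are the empty one, 0 and the alpha. *)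
Lemma weak_ito_taylor1E (q m : nat) (V : normedModType R) (S : sde R q m)
    (W : 'I_m -> R -> T -> R) (f : 'rV[R]_q -> R -> V) (t : R) (w : T) :
  weak_ito_taylor S P W 1 f t w =
  f (init S) 0
  + stoch_int P (fun _ _ => 1) (fun s _ => s) 0 t w *: L0 S f (init S) 0
  + \sum_alpha stoch_int P (fun _ _ => 1) (W alpha) 0 t w
      *: Lalpha S alpha f (init S) 0.
Proof.
rewrite /weak_ito_taylor !big_ord_recr big_ord0 /= add0r -addrA.
congr (_ + _).
  rewrite (big_pred1 [tuple]); last by move=> xi; rewrite [xi]tuple0 /= eqxx.
  by rewrite scale1r.
rewrite (reindex (fun k : 'I_m.+1 => [tuple k])) /=; last first.
  exists (fun xi : 1.-tuple 'I_m.+1 => thead xi) => // xi _.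
  by apply/val_inj; case: xi => -[|k [|]].
rewrite big_ord_recl /iterated_int /rev /= /Lentry /time_ext unlift_none.
congr (_ + _); apply: eq_bigr => alpha _.
by rewrite liftK.
Qed.

Lemma stoch_int_time (t : R) : 0 < t ->
  P.-integrable setT (EFin \o stoch_int P (fun _ _ => 1) (fun s _ => s) 0 t) /\
  (\int[P]_w (stoch_int P (fun _ _ => 1) (fun s _ => s) 0 t w)%:E = t%:E)%E.
Proof.
move=> t0.
have [mJ /ae_eq_sym aeJ] := @stoch_int_one _ _ _ P (fun s _ => s) 0 t (ltW t0)
  (measurable_cst _) (measurable_cst _).
have aeJE : ae_eq P setT (cst t%:E)
    (EFin \o stoch_int P (fun _ _ => 1) (fun s _ => s) 0 t).
  by apply: filterS aeJ => w H /H /= <-; rewrite subr0.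
have mJE := proj2 (measurable_EFinP _ _) mJ.
have [//| iJ ->] := ae_eq_integrable mJE aeJE _.
  exact: finite_measure_integrable_cst.
by rewrite integral_cst//= probability_setT mule1.
Qed.

Lemma stoch_int_brownian (W : R -> {RV P >-> R}) (t : R) : 0 < t ->
  brownian_motion W ->
  P.-integrable setT (EFin \o stoch_int P (fun _ _ => 1) (fun s => W s) 0 t) /\
  (\int[P]_w (stoch_int P (fun _ _ => 1) (fun s => W s) 0 t w)%:E = 0)%E.
Proof.
move=> t0 [_ _ _ /(_ 0 t (lexx _) t0)]; rewrite subr0 => lawW.
have st0 : Num.sqrt t != 0 by rewrite gt_eqF// sqrtr_gt0.
pose X : {RV P >-> R} := (W t \- W 0 : {mfun T >-> R}).
have [mJ /ae_eq_sym aeJ] := @stoch_int_one _ _ _ P (fun s => W s) 0 t (ltW t0)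
  (measurable_funPT _) (measurable_funPT _).
have iX := @centred_normal_integrable _ _ _ P _ X st0 lawW.
have X0 := @centred_normal_integral _ _ _ P _ X st0 lawW.
have aeJE : ae_eq P setT (EFin \o X)
    (EFin \o stoch_int P (fun _ _ => 1) (fun s => W s) 0 t).
  by apply: filterS aeJ => w H /H /= <-.
have mJE := proj2 (measurable_EFinP _ _) mJ.
by have [iJ ->] := ae_eq_integrable mJE aeJE iX; rewrite X0.
Qed.

(** The Brownian terms have mean 0 and the time integral is t, so only the
    initial value and the generator survive. *)
Lemma vexpectation_weak_ito_taylor1 (q m r : nat) (S : sde R q m)
    (W : 'I_m -> R -> {RV P >-> R}) (f : 'rV[R]_q -> R -> 'rV[R]_r) (t : R) :
  0 < t -> (forall alpha, brownian_motion (W alpha)) ->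
  vexpectation P (weak_ito_taylor S P (fun alpha s => W alpha s) 1 f t) =
  f (init S) 0 + t *: L0 S f (init S) 0.
Proof.
move=> t0 hW.
pose c0 := L0 S f (init S) 0; pose c alpha := Lalpha S alpha f (init S) 0.
have WE w : weak_ito_taylor S P (fun alpha s => W alpha s) 1 f t w =
    f (init S) 0 +
    stoch_int P (fun _ _ => 1) (fun s _ => s) 0 t w *: c0 +
    \sum_alpha stoch_int P (fun _ _ => 1) (fun s => W alpha s) 0 t w
      *: c alpha.
  exact: weak_ito_taylor1E.
(* The coefficients are made abstract, so that [mxE] does not unfold them. *)
rewrite -/c0; move: (f (init S) 0) WE => f0; clearbody c0 c => WE.
apply/rowP => j; rewrite !mxE.
pose J0 := stoch_int P (fun _ _ => 1) (fun s _ => s) 0 t.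
pose J alpha := stoch_int P (fun _ _ => 1) (fun s => W alpha s) 0 t.
have [iJ0 EJ0] := stoch_int_time t0.
have iJ alpha : P.-integrable setT (EFin \o J alpha) :=
  (stoch_int_brownian t0 (hW alpha)).1.
have EJ alpha : (\int[P]_w (J alpha w)%:E = 0)%E :=
  (stoch_int_brownian t0 (hW alpha)).2.
rewrite unlock.
have -> : (fun w =>
    (weak_ito_taylor S P (fun alpha s => W alpha s) 1 f t w 0 j)%:E) =
  (fun w => (f0 0 j)%:E + (J0 w)%:E * (c0 0 j)%:E
    + \sum_(alpha < m) (J alpha w)%:E * (c alpha 0 j)%:E)%E.
  apply/funext => w; rewrite WE !mxE summxE EFinD EFinD EFinM.
  rewrite -sumEFin; congr (_ + _)%E; apply: eq_bigr => alpha _.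
  by rewrite mxE EFinM.
have i0 : P.-integrable setT
    (fun w => (J0 w)%:E * (c0 0 j)%:E)%E.
  by apply: integrableZr => //; exact: iJ0.
have i1 alpha : P.-integrable setT
    (fun w => (J alpha w)%:E * (c alpha 0 j)%:E)%E.
  by apply: integrableZr => //; exact: iJ.
have ic : P.-integrable setT (fun _ : T => (f0 0 j)%:E).
  exact: finite_measure_integrable_cst.
rewrite integralD//; [|exact: integrableD|exact: integrable_sum].
rewrite integralD// integral_sum// integral_cst// integralZr// EJ0.
rewrite big1 => [|alpha _]; last first.
  by rewrite (integralZr measurableT (iJ alpha)) [X in (X * _)%E]EJ mul0e.
by rewrite /= probability_setT mule1 adde0.
Qed.
End expansion_of_order_one.

(** * The minimizing drift *)

Theorem theorem2 (R : realType) (d : measure_display) (T : measurableType d)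
    (P : probability T R) (r n m : nat)
    (W : 'I_m -> R -> {RV P >-> R})
    (hW : independent_brownian_motions W)
    (M U : set 'rV[R]_r)
    (psi : 'rV[R]_r -> 'rV[R]_n) (phi : 'rV[R]_n -> 'rV[R]_r)
    (hM : submanifold n M) (hchart : chart M U psi phi)
    (a : 'rV[R]_r -> R -> 'rV[R]_r) (b : 'I_m -> 'rV[R]_r -> R -> 'rV[R]_r)
    (A : 'rV[R]_n -> R -> 'rV[R]_n) (B : 'I_m -> 'rV[R]_n -> R -> 'rV[R]_n)
    (X0 : 'rV[R]_r) (hX0 : U X0) (t : R) (ht : 0 < t) :
  let Y0 := psi X0 in
  let error (A' : 'rV[R]_n -> R -> 'rV[R]_n) : R :=
    enorm (vexpectation P
      (weak_ito_taylor (stack (Sde a b X0) (Sde A' B Y0)) P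
        (fun alpha s => W alpha s) 1
        (fun z _ => lsubmx z - phi (rsubmx z)) t)) in
  (forall A', error A <= error A') <->
  A Y0 0 = inv_diff phi Y0 (orth_proj (tangent M X0)
    (a X0 0 - 2^-1 *: \sum_alpha \sum_beta
       gE R alpha beta *: nabla_diff phi Y0 (B alpha Y0 0) (B beta Y0 0))).
Proof.
move=> Y0 error.
set v := a X0 0 - _; set J := jacobian phi Y0.
have J_inj : forall u : 'rV_n, u *m J = 0 -> u = 0.
  exact: (chart_jacobian_inj hchart hX0).
have errorE A' : error A' = t * enorm (v - A' Y0 0 *m J).
  rewrite /error vexpectation_weak_ito_taylor1//; last by case: hW.
  rewrite /= row_mxKl row_mxKr (chart_phiK hchart hX0) subrr add0r.
  rewrite L0_gap ?enormZ ?ltW//; first exact: (chart_differentiable hchart hX0).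
  move=> j; have [_ _ _ _ [/(_ 2%N)[_ /(_ j)[dphi _]] _]] := hchart.
  by apply: dphi; exists X0.
have -> : inv_diff phi Y0 (orth_proj (tangent M X0) v) = v *m pinv J.
  rewrite (tangentE hchart hX0) (orth_proj_row_space J_inj).
  rewrite /inv_diff; case: xgetP => [w _ /=|/(_ (v *m pinv J))].
    rewrite -mul_rV_lin1 -/(jacobian phi Y0) -/J => /eqP.
    by rewrite -subr_eq0 -mulmxBl => /eqP/J_inj/eqP; rewrite subr_eq0 => /eqP.
  by rewrite /= -mul_rV_lin1.
rewrite -(least_squares J_inj); split=> [min_A w|min_A A'].
  by have := min_A (fun _ _ => w); rewrite !errorE ler_pM2l.
by rewrite !errorE ler_pM2l.
Qed.
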